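(* Let $n_1,N_1,n_2,N_2$ be positive integers with $N_1>n_1$, $N_2>n_2$ and $$\frac{1}{n_1^2}-\frac{1}{N_1^2}=\frac{1}{n_2^2}-\frac{1}{N_2^2}.$$ Let $L$ be a positive common multiple of $n_1,N_1,n_2,N_2$, and set $A=L/n_1$, $B=L/N_2$, $C=L/N_1$, $D=L/n_2$. Then there exist integers $r,s,u,v$ such that, as multisets, $$\{A,B\}=\{|ru-sv|,\,|rv+su|\}\quad\text{and}\quad \{C,D\}=\{|ru+sv|,\,|su-rv|\}.$$ In other words, every positive-integer equal-frequency transition pair $N_1\to n_1$, $N_2\to n_2$ is obtained, after clearing denominators and relabeling terms, from the Brahmagupta--Fibonacci parametrization.
   Context: In the Bohr model of hydrogen the energy levels are proportional to $-1/n^2$, with $n$ a positive integer. An equal-frequency transition pair $N_1\to n_1$, $N_2\to n_2$ consists of positive integers with $N_1>n_1$, $N_2>n_2$ and $\frac{1}{n_1^2}-\frac{1}{N_1^2}=\frac{1}{n_2^2}-\frac{1}{N_2^2}$. The Brahmagupta--Fibonacci parametrization assigns to integers $r,s,u,v$ the identity $(ru-sv)^2+(rv+su)^2=(ru+sv)^2+(su-rv)^2$. Signs, and the order of the two entries on each side, are disregarded. *)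

(* Defs.v *)
From mathcomp Require Export all_boot all_order all_algebra.

(* Main.v *)
Require Import Defs.
From mathcomp Require Import all_boot all_order all_algebra.
From mathcomp Require Import zify ring lra.

(** Clearing denominators turns the equal-frequency condition into
    [A^2 + B^2 = C^2 + D^2]. Squares modulo 4 show that, after possibly swapping
    [C] and [D], [A = C] and [B = D] modulo 2. The equation then reads
    [(A + C) / 2 * ((C - A) / 2) = (B + D) / 2 * ((B - D) / 2)], and the four
    number theorem splits these factors as [r u], [s v], [s u], [r v]. *)

Set Implicit Arguments.
Unset Strict Implicit.
Unset Printing Implicit Defensive.

Import Order.TTheory GRing.Theory Num.Theory.
Local Open Scope ring_scope.

(** Dividing [p] and [y] by their gcd [r] leaves coprime [u] and [v] with [u * q = x * v], so [u]
    divides [x], and [s] is the quotient. Since [p] is nonzero, [r] and [u] can be cancelled. *)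
Lemma four_numberz (p q x y : int) : p != 0 -> p * q = x * y ->
  exists r s u v : int, [/\ p = r * u, q = s * v, x = s * u & y = r * v].
Proof.
move=> p0 pq_xy.
set r := gcdz p y.
have r0 : r != 0 by rewrite gcdz_eq0 (negPf p0).
have /dvdzP[u pE] : (r %| p)%Z by exact: dvdz_gcdl.
have /dvdzP[v yE] : (r %| y)%Z by exact: dvdz_gcdr.
have u0 : u != 0 by apply: contra_neq p0 => u0; rewrite pE u0 mul0r.
have cop_uv : coprimez u v.
  have : gcdz u v * r = 1 * r.
    by rewrite mul1r; have := mulz_gcdl u v r; rewrite -pE -yE.
  by rewrite /coprimez => /(mulIf r0) ->.
have uq_xv : u * q = x * v.
  by apply: (mulIf r0); rewrite mulrAC -pE pq_xy yE mulrA.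
have /dvdzP[s xE] : (u %| x)%Z.
  by rewrite -(Gauss_dvdzl _ cop_uv) -uq_xv dvdz_mulr.
exists r, s, u, v; split=> //; rewrite 1?mulrC //.
by apply: (mulfI u0); rewrite uq_xv xE; ring.
Qed.

Lemma brahmagupta_same_parity (a b c d : int) (i j : bool) :
  let A := 2 * a + i%:Z in let B := 2 * b + j%:Z in
  let C := 2 * c + i%:Z in let D := 2 * d + j%:Z in
  0 < A -> 0 < C -> A ^+ 2 + B ^+ 2 = C ^+ 2 + D ^+ 2 ->
  exists r s u v : int, [/\ A = r * u - s * v, B = r * v + s * u,
    C = r * u + s * v & D = s * u - r * v].
Proof.
move=> A B C D A_gt0 C_gt0 sum_eq.
(* This is [(A + C) / 2], positive because [A] and [C] are. *)
have p0 : a + c + i%:Z != 0 by lia.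
have pq_xy : (a + c + i%:Z) * (c - a) = (b + d + j%:Z) * (b - d).
  apply: (@mulfI _ (4 : int)) => //.
  transitivity (C ^+ 2 - A ^+ 2); first by rewrite /A /C; ring.
  transitivity (B ^+ 2 - D ^+ 2); last by rewrite /B /D; ring.
  lia.
have [r [s [u [v [pE qE xE yE]]]]] := four_numberz p0 pq_xy.
(* Half-sums and half-differences recombine: [A = p - q], [C = p + q], [B = x + y], [D = x - y]. *)
by exists r, s, u, v; rewrite -pE -qE -xE -yE /A /B /C /D; split; ring.
Qed.

Lemma intz_halve (m : int) : exists (a : int) (i : bool), m = 2 * a + i%:Z.
Proof. by exists (m %/ 2)%Z, ((m %% 2)%Z == 1); lia. Qed.

Lemma sum_sqrz_brahmagupta (A B C D : int) :
  0 < A -> 0 < C -> 0 < D -> A ^+ 2 + B ^+ 2 = C ^+ 2 + D ^+ 2 ->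
  exists r s u v : int, [/\ A = r * u - s * v, B = r * v + s * u &
    (C = r * u + s * v /\ D = s * u - r * v) \/
    (D = r * u + s * v /\ C = s * u - r * v)].
Proof.
have [a [i ->]] := intz_halve A; have [b [j ->]] := intz_halve B.
have [c [k ->]] := intz_halve C; have [d [l ->]] := intz_halve D.
move=> A_gt0 C_gt0 D_gt0 sum_eq.
(* A square is congruent to its parity bit modulo 4, so [i + j] and [k + l] agree modulo 4. Both lie
   between 0 and 2, hence they are equal and the bits match up to order. *)
have sqr_odd m (e : bool) :
    (2 * m + e%:Z) ^+ 2 = 4 * (m ^+ 2 + m * e%:Z) + e%:Z :> int.
  by case: e => /=; ring.
have : (i = k /\ j = l) \/ (i = l /\ j = k).
  move: sum_eq; rewrite !sqr_odd.
  by case: i j k l {A_gt0 C_gt0 D_gt0} => [] [] [] [] /= sum_eq; auto; lia.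
case=> -[ik jl]; subst.
  have [r [s [u [v [AE BE CE DE]]]]] :=
    brahmagupta_same_parity A_gt0 C_gt0 sum_eq.
  by exists r, s, u, v; split=> //; left.
(* Here [A] shares its parity with [D], so [D] takes the place of [C]. *)
rewrite [RHS]addrC in sum_eq.
have [r [s [u [v [AE BE DE CE]]]]] := brahmagupta_same_parity A_gt0 D_gt0 sum_eq.
by exists r, s, u, v; split=> //; right.
Qed.

Lemma divz_gt0 (n L : int) : 0 < n -> 0 < L -> (n %| L)%Z -> 0 < (L %/ n)%Z.
Proof. by move=> n_gt0 L_gt0 /divzK nL; rewrite -(pmulr_lgt0 _ n_gt0) nL. Qed.

Lemma divz_ratE (n L : int) : n != 0 -> (n %| L)%Z ->
  ((L %/ n)%Z)%:Q = L%:Q / n%:Q.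
Proof.
move=> n0 /divzK {2}<-.
by rewrite intrM mulfK // intr_eq0.
Qed.

Theorem theorem2 (n1 N1 n2 N2 : int)
    (n1_gt0 : 0 < n1) (N1_gt0 : 0 < N1) (n2_gt0 : 0 < n2) (N2_gt0 : 0 < N2)
    (n1_lt_N1 : n1 < N1) (n2_lt_N2 : n2 < N2)
    (eq_freq : 1 / n1%:Q ^+ 2 - 1 / N1%:Q ^+ 2 = 1 / n2%:Q ^+ 2 - 1 / N2%:Q ^+ 2)
    (L : int) (L_gt0 : 0 < L)
    (n1_dvd_L : (n1 %| L)%Z) (N1_dvd_L : (N1 %| L)%Z)
    (n2_dvd_L : (n2 %| L)%Z) (N2_dvd_L : (N2 %| L)%Z)
    (A B C D : int)
    (def_A : A = (L %/ n1)%Z) (def_B : B = (L %/ N2)%Z)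
    (def_C : C = (L %/ N1)%Z) (def_D : D = (L %/ n2)%Z) :
  exists r s u v : int,
    perm_eq [:: A; B] [:: `|r * u - s * v|; `|r * v + s * u|] /\
    perm_eq [:: C; D] [:: `|r * u + s * v|; `|s * u - r * v|].
Proof.
have A_gt0 : 0 < A by rewrite def_A divz_gt0.
have B_gt0 : 0 < B by rewrite def_B divz_gt0.
have C_gt0 : 0 < C by rewrite def_C divz_gt0.
have D_gt0 : 0 < D by rewrite def_D divz_gt0.
have sum_eq : A ^+ 2 + B ^+ 2 = C ^+ 2 + D ^+ 2.
  (* Over the rationals the quotients are exact, both sides carry the factor [L ^+ 2], and what
     remains is [eq_freq] with its negative terms moved across. *)
  apply: (@intr_inj rat); rewrite !intrD !rmorphXn /=.
  rewrite def_A def_B def_C def_D !divz_ratE ?gt_eqF // !expr_div_n.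
  rewrite !div1r in eq_freq; rewrite -!mulrDr; congr (_ * _).
  lra.
have [r [s [u [v [AE BE CDE]]]]] := sum_sqrz_brahmagupta A_gt0 C_gt0 D_gt0 sum_eq.
exists r, s, u, v; rewrite -AE -BE.
(* All four numbers are positive, so the absolute values disappear; the second case differs only in
   the order of [C] and [D]. *)
by case: CDE => -[<- <-]; rewrite !gtr0_norm //; split=> //;
  rewrite (perm_catC [:: _] [:: _]).
Qed.
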